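(* Let $S_1 = (P_r, \sigma_1)$ be a signed path on $r$ vertices, let $S_2 = (C_s, \sigma_2)$ be a signed cycle on $s$ vertices, and let $S = S_1 \square S_2$ be their Cartesian product. If $r > 1$, then $\chi'(S) = \Delta(S)$.
   Context: All graphs are simple, finite and undirected; $P_r$ is the path on $r$ vertices and $C_s$ ($s\ge 3$) the cycle on $s$ vertices. A signed graph is a pair $S=(G,\sigma)$ where $G$ is a graph and $\sigma\colon E(G)\to\{+1,-1\}$; $G$ is the underlying graph. $V(S)$, $E(S)$ and $\Delta(S)$ (maximum degree) refer to the underlying graph. An incidence is a pair $v\text{:}e$ of a vertex $v$ and an edge $e$ having $v$ as an endpoint; $I(G)$ is the set of all incidences. For a positive integer $k$ let $M_k=\{0,\pm1,\ldots,\pm l\}$ if $k=2l+1$ and $M_k=\{\pm1,\ldots,\pm l\}$ if $k=2l$. A $k$-edge-coloring of $S=(G,\sigma)$ is a function $f\colon I(G)\to M_k$ such that $f(u\text{:}uv)=-\sigma(uv)f(v\text{:}uv)$ for each edge $uv$, and $f(u\text{:}uv_1)\neq f(u\text{:}uv_2)$ for any two distinct edges $uv_1\neq uv_2$ at a common vertex $u$. The chromatic index $\chi'(S)$ is the smallest $k$ for which $S$ has a $k$-edge-coloring. The Cartesian product $S_1\square S_2$ of signed graphs $S_1=(G_1,\sigma_1)$, $S_2=(G_2,\sigma_2)$ is the signed graph with vertex set $V(S_1)\times V(S_2)$ in which $(u,u')(v,v')$ is an edge iff either $u=v$ and $u'v'\in E(S_2)$ (the sign is then $\sigma_2(u'v')$),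 or $uv\in E(S_1)$ and $u'=v'$ (the sign is then $\sigma_1(uv)$). *)

(* Defs.v *)
From HB Require Import structures.
From mathcomp Require Import all_boot all_order all_algebra.
From mathcomp Require Import boolp.

Set Implicit Arguments.
Unset Strict Implicit.
Unset Printing Implicit Defensive.

Import GRing.Theory.
Local Open Scope ring_scope.

Record sgraph := SGraph {
  vertex :> finType;
  adj : rel vertex;
  adj_sym : symmetric adj;
  adj_irr : irreflexive adj }.

Definition degree (G : sgraph) (u : G) : nat := #|[set v : G | adj u v]|.

Definition max_degree (G : sgraph) : nat := (\max_(u : G) degree u)%N.

(* The edge uv is represented by the two ordered pairs (u, v) and (v, u), so a
   map on edges is a map of two vertices that is symmetric on adjacent ones;
   its values on non-adjacent pairs are irrelevant. *)
Record signature (G : sgraph) := Signature {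
  sign_of :> G -> G -> int;
  sign_sym : forall u v, adj u v -> sign_of u v = sign_of v u;
  sign_pm1 : forall u v, adj u v -> sign_of u v = 1 \/ sign_of u v = -1 }.

Record signed_graph := SignedGraph {
  underlying :> sgraph;
  sgn : signature underlying }.

(* M_k: the integers of absolute value at most k./2, without 0 if k is even. *)
Definition color_set (k : nat) : {pred int} :=
  [pred a : int | (`|a| <= k./2)%N && (odd k || (a != 0))].

(* f u v is the color of the incidence u:uv; only adjacent u, v matter. *)
Definition edge_coloring (S : signed_graph) (k : nat) (f : S -> S -> int) :=
  [/\ forall u v, adj u v -> f u v \in color_set k,
      forall u v, adj u v -> f u v = - sgn S u v * f v u
    & forall u v1 v2, adj u v1 -> adj u v2 -> v1 <> v2 -> f u v1 <> f u v2].

Definition edge_colorable (S : signed_graph) (k : nat) : Prop :=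
  exists f : S -> S -> int, edge_coloring k f.

(* Giving each edge its own absolute value yields a coloring. *)
Lemma edge_colorable_ex (S : signed_graph) :
  exists k, (0 < k)%N && `[< edge_colorable S k >].
Proof.
pose c (u v : S) : nat := (enum_rank [set u; v]).+1.
have cC u v : c u v = c v u by rewrite /c setUC.
pose f (u v : S) : int :=
  if (enum_rank u < enum_rank v)%N then (c u v)%:Z else - sgn S u v * (c u v)%:Z.
have sgn_abs u v : adj u v -> `|sgn S u v|%N = 1%N.
  by move=> /(@sign_pm1 _ (sgn S)) [] ->.
have fabs u v : adj u v -> `|f u v|%N = c u v.
  move=> uv; rewrite /f; case: ifP => // _.
  by rewrite abszM abszN sgn_abs // mul1n.
exists (#|{set S}|.*2)%N; apply/andP; split.
  by rewrite double_gt0; apply/card_gt0P; exists set0.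
apply/asboolP; exists f; split=> [u v uv|u v uv|u v1 v2 uv1 uv2 nv12 fE].
- rewrite inE doubleK fabs // ltn_ord -absz_eq0 fabs //.
  by rewrite orbT.
- have nuv : u != v by apply: contraTneq uv => ->; rewrite adj_irr.
  have nr : enum_rank u != enum_rank v by rewrite (inj_eq enum_rank_inj).
  rewrite /f -(cC u v) -(@sign_sym _ (sgn S) _ _ uv).
  have ss : sgn S u v * sgn S u v = 1.
    by case: (@sign_pm1 _ (sgn S) _ _ uv) => ->.
  move: nr; rewrite -val_eqE /= => nr.
  case: ltngtP nr => // _ _.
  by rewrite mulrA mulrNN ss mul1r.
- have : c u v1 = c u v2 by rewrite -!fabs // fE.
  move=> [] /val_inj /enum_rank_inj /setP /(_ v1).
  rewrite !inE eqxx orbT => /esym /orP [] /eqP // E.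
  by move: uv1; rewrite E adj_irr.
Qed.

Definition chromatic_index (S : signed_graph) : nat :=
  ex_minn (edge_colorable_ex S).

Section PathGraph.
Variable r : nat.

Definition path_adj : rel 'I_r :=
  [rel i j : 'I_r | (i.+1 == j :> nat) || (j.+1 == i :> nat)].

Lemma path_adj_sym : symmetric path_adj.
Proof. by move=> i j; apply: orbC. Qed.

Lemma path_adj_irr : irreflexive path_adj.
Proof. by move=> i; rewrite /path_adj /= orbb gtn_eqF. Qed.

Definition path_graph : sgraph := SGraph path_adj_sym path_adj_irr.
End PathGraph.

Section CycleGraph.
Variables (s : nat) (s_ge3 : (2 < s)%N).

Definition cycle_adj : rel 'I_s := [rel i j : 'I_s | (j == ordS i) || (i == ordS j)].

Lemma cycle_adj_sym : symmetric cycle_adj.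
Proof. by move=> i j; apply: orbC. Qed.

Lemma cycle_adj_irr : irreflexive cycle_adj.
Proof.
move=> i; rewrite /cycle_adj /= orbb -val_eqE /=; have := ltn_ord i.
rewrite leq_eqVlt => /orP [/eqP E|lt_is]; last by rewrite modn_small // ltn_eqF.
rewrite [X in (_ == X %% s)%N]E modnn; apply/eqP => i0.
by move: s_ge3; rewrite -E i0.
Qed.

Definition cycle_graph : sgraph := SGraph cycle_adj_sym cycle_adj_irr.
End CycleGraph.

Section CartesianProduct.
Variables S1 S2 : signed_graph.

Definition cart_adj : rel (S1 * S2)%type :=
  [rel p q : S1 * S2 | ((p.1 == q.1) && adj p.2 q.2) || (adj p.1 q.1 && (p.2 == q.2))].

Lemma cart_adj_sym : symmetric cart_adj.
Proof.
by move=> p q; rewrite /cart_adj /= (eq_sym p.1) (eq_sym p.2) (adj_sym p.1) (adj_sym p.2).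
Qed.

Lemma cart_adj_irr : irreflexive cart_adj.
Proof. by move=> p; rewrite /cart_adj /= !adj_irr andbF. Qed.

Definition cart_graph : sgraph := SGraph cart_adj_sym cart_adj_irr.

Definition cart_sign (p q : cart_graph) : int :=
  if p.1 == q.1 then sgn S2 p.2 q.2 else sgn S1 p.1 q.1.

Lemma cart_sign_sym p q : adj p q -> cart_sign p q = cart_sign q p.
Proof.
rewrite -[adj p q]/(cart_adj p q) /cart_adj /cart_sign /= (eq_sym q.1).
case: eqP => [->|_] /=; first by rewrite adj_irr orbF; exact: sign_sym.
by case/andP=> + _; exact: sign_sym.
Qed.

Lemma cart_sign_pm1 p q : adj p q -> cart_sign p q = 1 \/ cart_sign p q = -1.
Proof.
rewrite -[adj p q]/(cart_adj p q) /cart_adj /cart_sign /=.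
case: eqP => [->|_] /=; first by rewrite adj_irr orbF; exact: sign_pm1.
by case/andP=> + _; exact: sign_pm1.
Qed.

Definition cart_prod : signed_graph :=
  SignedGraph (Signature cart_sign_sym cart_sign_pm1).
End CartesianProduct.

(* Main.v *)
(* Both factors enter the signature of the product repeatedly, so every face of
   the grid P_r x C_s is balanced. Multiplying the colors at each vertex (i, j)
   by partial products of - sigma_1 and - sigma_2 makes the two colors of every
   edge equal, except on the edges closing the rows, where they differ by a
   fixed sign tau. It remains to decompose the grid into paths and cycles whose
   circuits are symmetric under a reflection, hence traverse an even number of
   closing edges, and to alternate signs along them: one such family and a
   perfect matching (color 0) for r = 2, two families for r > 2. *)
Require Import Defs.
From mathcomp Require Import all_boot all_order all_algebra.
From mathcomp Require Import boolp zify ring.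

Set Implicit Arguments.
Unset Strict Implicit.
Unset Printing Implicit Defensive.

Import GRing.Theory.
Local Open Scope ring_scope.

(** * Degree bounds on the chromatic index *)

Lemma degree_le_colors (S : signed_graph) (k : nat) (u : S) :
  edge_colorable S k -> (degree u <= k)%N.
Proof.
case=> f [f_col _ f_inj].
(* [cs] lists the color set; [Negz i] is [-(i + 1)], hence the two starting points. *)
pose cs : seq int := [seq Posz i | i <- iota 1 k./2] ++
  [seq Negz i | i <- iota 0 k./2] ++ (if odd k then [:: 0] else [::]).
have size_cs : size cs = k.
  rewrite !size_cat !size_map !size_iota.
  by rewrite -[RHS](odd_double_half k) -addnn; case: (odd k) => /=; lia.
rewrite /degree -size_cs cardE -(size_map (f u)); apply: uniq_leq_size.
  rewrite map_inj_in_uniq ?enum_uniq // => v1 v2.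
  rewrite !mem_enum !inE => uv1 uv2 fE.
  by apply/eqP/negP => /negP/eqP /(f_inj _ _ _ uv1 uv2).
move=> _ /mapP [v + ->]; rewrite mem_enum inE => /f_col.
rewrite inE !mem_cat; case: (f u v) => n /andP [le_n nz].
  case: n le_n nz => [|n] le_n nz.
    by move: nz; rewrite orbF => ->; rewrite inE eqxx !orbT.
  by apply/orP; left; apply: map_f; rewrite mem_iota; move: le_n => /=; lia.
apply/orP; right; apply/orP; left; apply: map_f; rewrite mem_iota.
by move: le_n => /=; lia.
Qed.

Lemma degree_ge (G : sgraph) (u : G) (vs : seq G) :
  uniq vs -> all (adj u) vs -> (size vs <= degree u)%N.
Proof.
move=> uniq_vs /allP adj_vs; rewrite /degree cardE; apply: uniq_leq_size => // v.
by rewrite mem_enum inE; apply: adj_vs.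
Qed.

Lemma max_degree_le_chromatic_index (S : signed_graph) :
  (max_degree S <= chromatic_index S)%N.
Proof.
rewrite /chromatic_index; case: ex_minnP => k /andP [_ /asboolP col_k] _.
by apply/bigmax_leqP => u _; apply: degree_le_colors.
Qed.

Lemma chromatic_index_le (S : signed_graph) (k : nat) :
  (0 < k)%N -> edge_colorable S k -> (chromatic_index S <= k)%N.
Proof.
move=> k_gt0 col_k; rewrite /chromatic_index; case: ex_minnP => m _; apply.
by rewrite k_gt0; apply/asboolP.
Qed.

(** * Signs and switching *)

Definition pm1 (x : int) := x = 1 \/ x = -1.

Lemma pm1M x y : pm1 x -> pm1 y -> pm1 (x * y).
Proof. by case=> ->; case=> ->; [left|right|right|left]. Qed.

Lemma pm1N x : pm1 x -> pm1 (- x).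
Proof. by case=> ->; [right|left]. Qed.

Lemma pm1_mulK x : pm1 x -> x * x = 1.
Proof. by case=> ->. Qed.

Lemma color_setM k x a : pm1 x -> (x * a \in color_set k) = (a \in color_set k).
Proof. by case=> ->; rewrite ?mul1r // mulN1r !inE abszN oppr_eq0. Qed.

Definition switching (a : nat -> int) (n : nat) : int := \prod_(k < n) (- a k).

Lemma switchingS a n : switching a n.+1 = - a n * switching a n.
Proof. by rewrite /switching big_ord_recr mulrC. Qed.

Lemma switching_pm1 a n :
  (forall k, (k < n)%N -> pm1 (a k)) -> pm1 (switching a n).
Proof.
elim: n => [|n IHn] a_pm1; first by left; rewrite /switching big_ord0.
rewrite switchingS; apply: pm1M; first exact/pm1N/a_pm1.
by apply: IHn => k lt_kn; apply: a_pm1; apply: ltnW.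
Qed.

(* A direction (vertical, forward) encodes (true, true) = to row i + 1,
   (true, false) = to row i - 1, (false, true) = to column j + 1 mod s,
   (false, false) = to column j - 1 mod s. *)
Definition present (r i : nat) (d : bool * bool) : bool :=
  d.1 ==> (if d.2 then i.+1 < r else 0 < i)%N.

(* R i j and U i j are the colors at (i, j) of the edges to column j + 1 and to
   row i + 1; tau twists the color across the edges closing the rows. *)
Definition grid_color (s : nat) (tau : int) (R U : nat -> nat -> int)
    (i j : nat) (d : bool * bool) : int :=
  match d with
  | (true, true) => U i j
  | (true, false) => U i.-1 j
  | (false, true) => R i j
  | (false, false) => if j is j'.+1 then R i j' else tau * R i s.-1
  end.

(** Up to [tau], both ends of an edge read the same entry of [R] or [U], so the sign condition is
    built in; membership and distinctness remain. *)
Definition grid_coloring r s k tau (R U : nat -> nat -> int) :=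
  forall i j, (i < r)%N -> (j < s)%N ->
  {in present r i, forall d, grid_color s tau R U i j d \in color_set k} /\
  {in present r i &, injective (grid_color s tau R U i j)}.

(** * From grid colorings to the product *)

Section Grid.
Variables (r s : nat) (s_ge3 : (2 < s.+1)%N).
Variables (sigma1 : signature (path_graph r.+1))
          (sigma2 : signature (cycle_graph s_ge3)).

Let S := cart_prod (SignedGraph sigma1) (SignedGraph sigma2).
Let a (i : nat) : int := sigma1 (inord i) (inord i.+1).
Let b (j : nat) : int := sigma2 (inord j) (ordS (inord j)).
Let tau := switching b s.+1.

Definition direction (u v : 'I_r.+1 * 'I_s.+1) : bool * bool :=
  (u.1 != v.1, if u.1 == v.1 then v.2 == ordS u.2 else (u.1 < v.1)%N).

(** Since the cycle has length at least 3, the two row directions never coincide. *)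
Lemma ordS_asym (j : 'I_s.+1) : j <> ordS (ordS j).
Proof.
case: j => j lt_js /(congr1 val) /=.
have [lt_j1s|] := ltnP j.+1 s; first by rewrite !modn_small; lia.
rewrite leq_eqVlt => /orP [/eqP E|lt_sj].
  by rewrite (modn_small (_ : j.+1 < _)%N) -?E ?modnn //; lia.
have -> : j = s by lia.
by rewrite modnn modn_small; lia.
Qed.

Lemma grid_adjP (u v : S) : adj u v ->
  [\/ [/\ direction u v = (false, true), v.1 = u.1 & v.2 = ordS u.2],
      [/\ direction u v = (false, false), v.1 = u.1 & u.2 = ordS v.2],
      [/\ direction u v = (true, true), v.2 = u.2 & v.1 = u.1.+1 :> nat]
    | [/\ direction u v = (true, false), v.2 = u.2 & u.1 = v.1.+1 :> nat]].
Proof.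
rewrite /direction => /orP [] /andP [].
  move=> /eqP E /orP [] /eqP E2; first by apply: Or41; rewrite E E2 !eqxx.
  apply: Or42; rewrite E E2 eqxx; split=> //.
  by congr (_, _); apply/eqP; apply: ordS_asym.
move=> /orP [] /eqP E /eqP E2; [apply: Or43|apply: Or44].
  by rewrite -val_eqE /= -E ltn_eqF // ltnSn.
by rewrite -val_eqE /= -E gtn_eqF // ltnNge leqnSn.
Qed.

Lemma direction_present (u v : S) : adj u v -> direction u v \in present r.+1 u.1.
Proof.
case/grid_adjP => [] [-> _ E] //; rewrite unfold_in /present /= ?E //.
by rewrite -E ltn_ord.
Qed.

Lemma direction_inj (u v1 v2 : S) : adj u v1 -> adj u v2 ->
  direction u v1 = direction u v2 -> v1 = v2.
Proof.
have inj2 (v w : S) : v.1 = w.1 -> v.2 = w.2 -> v = w.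
  by case: v w => [? ?] [? ?] /= -> ->.
move=> /grid_adjP A1 /grid_adjP A2 D.
case: A1 => [] [D1 E1 F1]; move: A2; rewrite -D D1.
all: case=> [] [] // _ E2 F2; apply: inj2; rewrite ?E1 ?E2 ?F1 ?F2 //.
- by apply: (can_inj (@ordSK _)); rewrite -F1 -F2.
- by apply: val_inj; rewrite /= F1 F2.
- by apply: val_inj; apply: succn_inj; rewrite -F1 -F2.
Qed.

Definition grid_lift (R U : nat -> nat -> int) (u v : S) : int :=
  switching a u.1 * switching b u.2 *
  grid_color s.+1 tau R U u.1 u.2 (direction u v).

Lemma a_sigma1 (i i' : 'I_r.+1) : i' = i.+1 :> nat -> sigma1 i i' = a i.
Proof. by move=> E; rewrite /a inord_val -E inord_val. Qed.

Lemma a_pm1 i : (i < r)%N -> pm1 (a i).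
Proof.
move=> lt_ir; apply: (sign_pm1 sigma1).
by rewrite /= /path_adj /= !inordK ?eqxx //; lia.
Qed.

Lemma b_pm1 j : pm1 (b j).
Proof. by apply: (sign_pm1 sigma2); rewrite /= /cycle_adj /= eqxx. Qed.

Lemma b_sigma2 (j : 'I_s.+1) : sigma2 j (ordS j) = b j.
Proof. by rewrite /b inord_val. Qed.

Lemma tau_pm1 : pm1 tau.
Proof. by apply: switching_pm1 => j _; apply: b_pm1. Qed.

Lemma switch_pm1 (u : S) : pm1 (switching a u.1 * switching b u.2).
Proof.
apply: pm1M; apply: switching_pm1 => k lt_k; last exact: b_pm1.
by apply: a_pm1; apply: leq_trans lt_k _; rewrite -ltnS.
Qed.

Lemma grid_liftE R U (u v : S) : adj u v ->
  grid_lift R U u v = - sgn S u v * grid_lift R U v u.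
Proof.
wlog fwd : u v / (direction u v).2.
  move=> IH uv; have vu : adj v u by rewrite adj_sym.
  case fwd_uv: (direction u v).2; first exact: IH.
  have /IH -> // : (direction v u).2.
    case/grid_adjP: (uv) fwd_uv => [] [-> E F] // _.
      by rewrite /direction E F !eqxx.
    by rewrite /direction -!val_eqE /= F ltn_eqF ltnS.
  by rewrite (sign_sym _ uv) mulrA mulrNN pm1_mulK ?mul1r //; apply: sign_pm1.
move=> uv.
case/grid_adjP: uv => [] [D E F]; move: fwd; rewrite D //= => _.
- have D' : direction v u = (false, false).
    by rewrite /direction E F !eqxx /=; congr (_, _); apply/eqP/ordS_asym.
  rewrite /grid_lift D D' /= E F /= /cart_sign E eqxx F b_sigma2.
  (* On a closing edge the head is in column 0, where the partial product restarts at 1; [tau]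
     supplies the full product. *)
  have := ltn_ord u.2; rewrite ltnS leq_eqVlt => /orP [/eqP Eu|lt_us].
    rewrite Eu modnn /= /tau switchingS [switching b 0]big_ord0.
    by case: (b_pm1 s) => ->; ring.
  by rewrite modn_small //= switchingS; case: (b_pm1 u.2) => ->; ring.
have D' : direction v u = (true, false).
  by rewrite /direction -!val_eqE /= F gtn_eqF ?ltnSn // ltnNge leqnSn.
have lt_ur : (u.1 < r)%N by rewrite -ltnS -F ltn_ord.
rewrite /grid_lift D D' /= E F /= /cart_sign -val_eqE /= F ltn_eqF //.
by rewrite (a_sigma1 F) switchingS; case: (a_pm1 lt_ur) => ->; ring.
Qed.

Lemma grid_colorable k R U : grid_coloring r.+1 s.+1 k tau R U -> edge_colorable S k.
Proof.
move=> RU; exists (grid_lift R U); split=> [u v uv|u v|u v1 v2 uv1 uv2 nv12 fE].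
- rewrite /grid_lift color_setM; last exact: switch_pm1.
  by have [col _] := RU u.1 u.2 (ltn_ord _) (ltn_ord _); apply/col/direction_present.
- exact: grid_liftE.
apply: nv12; have [_ inj] := RU u.1 u.2 (ltn_ord _) (ltn_ord _).
apply: (direction_inj uv1 uv2); apply: inj; try exact: direction_present.
apply: (@mulfI _ (switching a u.1 * switching b u.2)) fE.
by case: (switch_pm1 u) => ->.
Qed.

Lemma max_degree_ge : (0 < r)%N -> (3 + (1 < r) <= max_degree S)%N.
Proof.
move=> r_gt0; pose j0 : 'I_s.+1 := ord0; pose i1 : 'I_r.+1 := inord 1.
have ne_j : ordS j0 != ord_pred j0.
  by apply/eqP => E; apply: (@ordS_asym j0); rewrite E ord_predK.
have ne_S : ordS j0 != j0 by apply/eqP => E; apply: (@ordS_asym j0); rewrite !E.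
have ne_P : ord_pred j0 != j0.
  by apply: contraNneq ne_S => E; rewrite -{1}E ord_predK.
have i1E : i1 = 1%N :> nat by rewrite inordK.
(* Row 2 exists only if [1 < r]; otherwise [i2] is a default value and [vs] omits it. *)
have [i2 i2E] : exists i2 : 'I_r.+1, (1 < r)%N -> i2 = 2%N :> nat.
  by exists (inord 2) => r_gt1; rewrite inordK.
pose vs : seq S := [:: (i1, ordS j0), (i1, ord_pred j0), (ord0, j0) &
  if (1 < r)%N then [:: (i2, j0)] else [::]].
have -> : (3 + (1 < r) = size vs)%N by rewrite /vs; case: ifP.
apply: leq_trans (leq_bigmax (i1, j0)); apply: degree_ge.
  rewrite /vs; case: ifP => r_gt1 /=; last first.
    by rewrite !inE !xpair_eqE !eqxx /= (negPf ne_j) (negPf ne_S) (negPf ne_P) !andbF.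
  rewrite !inE !xpair_eqE !eqxx /= (negPf ne_j) (negPf ne_S) (negPf ne_P) !andbF.
  by rewrite /= !andbT; apply/eqP => /(congr1 val); rewrite /= i2E.
have adj_i1_0 : path_adj i1 ord0 by rewrite /path_adj /= i1E.
have adj_i1_i2 : (1 < r)%N -> path_adj i1 i2.
  by move=> r_gt1; rewrite /path_adj /= i1E i2E ?eqxx.
rewrite /vs /= /cart_adj /= /cycle_adj /= !eqxx ord_predK eqxx !orbT adj_i1_0 !orbT /=.
by case: ifP => //= r_gt1; rewrite adj_i1_i2 ?orbT.
Qed.

End Grid.

(* Color 0 is given to every other pair of parallel row edges and, for s odd,
   to the edge joining (0, 0) and (1, 0); the rest splits into faces and, for s
   odd, one hexagon made of the two faces around that edge. *)
Definition prism_R (s : nat) (tau : int) (i j : nat) : int :=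
  if odd s && (j == 0)%N then - tau else if odd j then 0 else 1.

Definition prism_U (s : nat) (tau : int) (i j : nat) : int :=
  if odd s && (j <= 1)%N then (if j == 0 then 0 else tau) else -1.

Lemma prism_coloring s tau : (2 < s)%N -> pm1 tau ->
  grid_coloring 2 s 3 tau (prism_R s tau) (prism_U s tau).
Proof.
move=> s_gt2 tau_pm1 i j lt_i2 lt_js.
have S0 : s.-1 == 0%N = false by lia.
have odd_s1 : odd s.-1 = ~~ odd s by case: s s_gt2 {lt_js S0} => //= s _; rewrite negbK.
rewrite /grid_color /prism_R /prism_U S0 odd_s1 andbF.
move: lt_i2 {S0 odd_s1 s_gt2}; case: i => [|[|//]] _.
(* Beyond columns 0 and 1 only the parities of [j] and [s] and the sign [tau] matter. *)
all: case: j lt_js => [|[|j]] lt_js /=; rewrite ?negbK.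
all: case: tau_pm1 => tauE; rewrite ?tauE; case: (odd s) => /=; try case: (odd j).
all: by split; [move=> [[] []]|move=> [[] []] [[] []]].
Qed.

(* Start from rows in color +-1 and columns in color +-2. The face between
   columns 0 and 1 has alternating colors, and swapping them merges rows i and
   i + 1 into one balanced circuit; this is done for every second pair of rows,
   starting from the last. If r is odd, row 0 is left over, but its edge between
   columns 0 and 1 may take color 2 as the vertices of row 0 have degree 3. *)
Definition grid_R (i j : nat) : int :=
  if j == 0%N then 2 else if odd j then -1 else 1.

Definition grid_U (r s : nat) (tau : int) (i j : nat) : int :=
  if (j <= 1)%N then
    (if odd (r + i) then -2 else if j == 0%N then (-1) ^+ s * tau else 1)
  else (if odd i then -2 else 2).

(** In column 0 the closing edge has color [- (-1) ^+ s * tau], which leaves [(-1) ^+ s * tau] for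
    the column edge of a merged pair of rows. *)
Lemma grid_coloring4 r s tau : (2 < s)%N -> pm1 tau ->
  grid_coloring r s 4 tau grid_R (grid_U r s tau).
Proof.
move=> s_gt2 tau_pm1 i j lt_ir lt_js.
have S0 : s.-1 == 0%N = false by lia.
have odd_s1 : odd s.-1 = ~~ odd s by case: s s_gt2 {lt_js S0} => //= s _; rewrite negbK.
rewrite /grid_color /grid_R /grid_U S0 odd_s1 -signr_odd !oddD.
case: i lt_ir => [|i] lt_ir; case: j lt_js => [|[|j]] lt_js /=; rewrite ?negbK ?addbF ?addbN.
all: case: tau_pm1 => tauE; rewrite ?tauE; case: (odd s); case: (odd r); try case: (odd i); try case: (odd j).
all: by split; [move=> [[] []]|move=> [[] []] [[] []]].
Qed.

Theorem theorem8 (r s : nat) (r_gt1 : (1 < r)%N) (s_ge3 : (2 < s)%N)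
    (sigma1 : signature (path_graph r)) (sigma2 : signature (cycle_graph s_ge3)) :
  let S := cart_prod (SignedGraph sigma1) (SignedGraph sigma2) in
  chromatic_index S = max_degree S.
Proof.
case: r r_gt1 sigma1 => // r' r_gt0 sigma1'; case: s s_ge3 sigma2 => // s' s'_ge3 sigma2' S.
apply/eqP; rewrite eqn_leq max_degree_le_chromatic_index andbT.
(* The degree bound is the number of colors used: 3 for two rows, 4 otherwise. *)
apply: leq_trans (max_degree_ge sigma1' sigma2' r_gt0).
apply: chromatic_index_le => //.
have tau_pm1 := tau_pm1 sigma2'.
case: ltnP => [r'_gt1|r'_le1]; apply: grid_colorable.
  exact: grid_coloring4.
have -> : r'.+1 = 2%N by lia.
exact: prism_coloring.
Qed.
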